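(* The properties $\mathrm{AC}$, $\mathrm{UN}$ and $\mathrm{UN}^{\to}$ of abstract rewrite systems are generalised first-order properties, but not first-order properties.
   Context: An ARS is a pair $(A,\to)$, $A$ non-empty, ${\to}\subseteq A\times A$; $\to^+$ is the transitive closure, $\twoheadrightarrow$ the reflexive transitive closure and $\leftrightarrow^*$ the reflexive transitive closure of ${\to}\cup{\leftarrow}$. A normal form is an element with no outgoing step. AC (acyclic): $a\to^+b$ implies $a\neq b$. UN: for all normal forms $a,b$, $a\leftrightarrow^*b$ implies $a=b$. $\mathrm{UN}^{\to}$: for all normal forms $a,b$, if $x\twoheadrightarrow a$ and $x\twoheadrightarrow b$ for some $x$ then $a=b$. A property $P$ of ARSs is a first-order property if there is a single sentence $\phi$ of first-order logic with equality and a binary predicate symbol $\to$ (interpreted as the one-step relation) such that for every ARS $\mathcal{A}$, $\mathcal{A}$ has $P$ iff $\mathcal{A}\models\phi$; it is a generalised first-order property if the same holds with a set $\Phi$ of such sentences instead of a single sentence. *)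

(* Defs.v *)
From Stdlib Require Import Relations.

Record ARS : Type := mkARS {
  carrier :> Type;
  step : relation carrier;
  carrier_nonempty : inhabited carrier
}.

Arguments step {_} _ _.

Definition steps_plus (A : ARS) : relation A := clos_trans A step.

Definition steps (A : ARS) : relation A := clos_refl_trans A step.

Definition conv (A : ARS) : relation A :=
  clos_refl_trans A (union A step (transp A step)).

Definition normal_form (A : ARS) (a : A) : Prop := ~ exists b : A, step a b.

Definition AC (A : ARS) : Prop :=
  forall a b : A, steps_plus A a b -> a <> b.

Definition UN (A : ARS) : Prop :=
  forall a b : A, normal_form A a -> normal_form A b -> conv A a b -> a = b.

Definition UN_to (A : ARS) : Prop :=
  forall a b : A, normal_form A a -> normal_form A b ->
    (exists x : A, steps A x a /\ steps A x b) -> a = b.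

(* First-order logic with equality over one binary predicate symbol;
   variables are named by natural numbers. *)
Inductive formula : Type :=
| FEq (x y : nat)
| FStep (x y : nat)
| FBot
| FNot (f : formula)
| FAnd (f g : formula)
| FOr (f g : formula)
| FImp (f g : formula)
| FAll (x : nat) (f : formula)
| FEx (x : nat) (f : formula).

Fixpoint free_in (z : nat) (f : formula) : Prop :=
  match f with
  | FEq x y | FStep x y => z = x \/ z = y
  | FBot => False
  | FNot g => free_in z g
  | FAnd g h | FOr g h | FImp g h => free_in z g \/ free_in z h
  | FAll x g | FEx x g => z <> x /\ free_in z g
  end.

Definition sentence (f : formula) : Prop := forall z : nat, ~ free_in z f.

Definition update (A : Type) (v : nat -> A) (x : nat) (a : A) : nat -> A :=
  fun y => if Nat.eqb y x then a else v y.

Fixpoint holds (A : ARS) (v : nat -> A) (f : formula) : Prop :=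
  match f with
  | FEq x y => v x = v y
  | FStep x y => step (v x) (v y)
  | FBot => False
  | FNot g => ~ holds A v g
  | FAnd g h => holds A v g /\ holds A v h
  | FOr g h => holds A v g \/ holds A v h
  | FImp g h => holds A v g -> holds A v h
  | FAll x g => forall a : A, holds A (update A v x a) g
  | FEx x g => exists a : A, holds A (update A v x a) g
  end.

(* The carrier is non-empty, so valuations exist; the truth value of a
   sentence does not depend on the valuation. *)
Definition models (A : ARS) (f : formula) : Prop :=
  forall v : nat -> A, holds A v f.

Definition first_order_property (P : ARS -> Prop) : Prop :=
  exists f : formula, sentence f /\ forall A : ARS, P A <-> models A f.

Definition generalised_first_order_property (P : ARS -> Prop) : Prop :=
  exists F : formula -> Prop,
    (forall f : formula, F f -> sentence f) /\
    forall A : ARS, P A <-> (forall f : formula, F f -> models A f).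

(* Main.v *)
(** Each property forbids certain paths of length [k], for all [k], and for a
    fixed [k] this is first-order. For the negative part, take systems [B n]
    that violate the property, but only by paths whose length grows with [n].
    Every axiom then holds in almost all [B n], hence in their ultraproduct by
    Łoś's theorem, so the ultraproduct has the property. A single sentence
    defining the property would hold in the ultraproduct, hence in some [B n],
    which is absurd. *)

From mathcomp Require Import all_boot all_algebra zify.
From mathcomp Require Import boolp classical_sets filter.
From Stdlib Require Import Relations.
Require Import Defs.

Set Implicit Arguments.
Unset Strict Implicit.
Unset Printing Implicit Defensive.

Import Num.Theory.
Local Open Scope classical_set_scope.

(** * Ultraproducts *)

Lemma holds_eq_free (A : ARS) (f : formula) : forall v w : nat -> A,
  (forall z, free_in z f -> v z = w z) -> holds A v f <-> holds A w f.
Proof.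
have upd x g (IHg : forall v w : nat -> A, (forall z, free_in z g -> v z = w z) ->
      holds A v g <-> holds A w g) (v w : nat -> A) :
    (forall z, z <> x /\ free_in z g -> v z = w z) ->
    forall a, holds A (update A v x a) g <-> holds A (update A w x a) g.
  move=> vw a; apply: IHg => z zg; rewrite /update.
  by case: PeanoNat.Nat.eqb_spec => // zx; apply: vw.
elim: f => /=.
- by move=> x y v w vw; rewrite !vw; auto.
- by move=> x y v w vw; rewrite !vw; auto.
- by [].
- by move=> f IHf v w vw; rewrite (IHf v w).
- by move=> f IHf g IHg v w vw; rewrite (IHf v w) ?(IHg v w) //; auto.
- by move=> f IHf g IHg v w vw; rewrite (IHf v w) ?(IHg v w) //; auto.
- by move=> f IHf g IHg v w vw; rewrite (IHf v w) ?(IHg v w) //; auto.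
- move=> x f IHf v w vw; have E := upd x f IHf v w vw.
  by split=> H a; apply/E.
- move=> x f IHf v w vw; have E := upd x f IHf v w vw.
  by split=> -[a /E H]; exists a.
Qed.

Lemma models_sentence (A : ARS) (f : formula) (v : nat -> A) :
  sentence f -> models A f <-> holds A v f.
Proof.
move=> sf; split=> [|fv w]; first exact.
by rewrite -(@holds_eq_free A f v w) // => z /sf.
Qed.

Section Ultrafilter.
Variables (T : Type) (G : set_system T).
Hypothesis GU : UltraFilter G.

Lemma ultraN (P : set T) : G [set t | ~ P t] <-> ~ G P.
Proof.
split=> [GNP GP|]; last by case: (in_ultra_setVsetC P GU).
by have [t []] := filter_ex (filterI GNP GP).
Qed.

Lemma ultraI (P Q : set T) : G [set t | P t /\ Q t] <-> G P /\ G Q.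
Proof.
split=> [GPQ|[GP GQ]]; last exact: filterI.
by split; apply: filterS GPQ => t [].
Qed.

Lemma ultraU (P Q : set T) : G [set t | P t \/ Q t] <-> G P \/ G Q.
Proof.
split=> [GPQ|[] GP]; [|by apply: filterS GP; left|by apply: filterS GP; right].
have [GP|/ultraN GNP] := pselect (G P); first by left.
by right; apply: filterS (filterI GPQ GNP) => t [[]].
Qed.

Lemma ultra_imply (P Q : set T) : G [set t | P t -> Q t] <-> (G P -> G Q).
Proof.
split=> [GPQ GP|GPQ]; first by apply: filterS (filterI GPQ GP) => t []; apply.
have [/GPQ GQ|/ultraN GNP] := pselect (G P); first by apply: filterS GQ => t Qt _.
by apply: filterS GNP => t NPt /NPt.
Qed.

End Ultrafilter.

Section Ultraproduct.
Variables (I : Type) (G : set_system I).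
Hypothesis GU : UltraFilter G.
Variable B : I -> ARS.

Let product := forall i, B i.

Definition ultra_eq (f : product) : set product := [set g | G [set i | f i = g i]].

(** The quotient of the product by equality on a [G]-large set: its points are the equivalence
    classes themselves, as subsets of the product. *)
Definition ultra_carrier := {p : set product | exists f, p = ultra_eq f}.

Definition ultra_class (f : product) : ultra_carrier :=
  exist _ (ultra_eq f) (ex_intro _ f erefl).

Definition ultra_repr (p : ultra_carrier) : product := sval (cid (svalP p)).

Lemma ultra_reprE p : sval p = ultra_eq (ultra_repr p).
Proof. exact: svalP (cid (svalP p)). Qed.

Lemma ultra_eq_class f g : G [set i | f i = g i] <-> ultra_eq f = ultra_eq g.
Proof.
split=> [fg|fg]; last first.
  suff: ultra_eq f g by [].
  by rewrite fg; apply: filterS filterT => i.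
rewrite predeqE => h; split=> [fh|gh].
  by apply: filterS (filterI fg fh) => i /= [<-].
by apply: filterS (filterI fg gh) => i /= [->].
Qed.

Lemma ultra_repr_class f : G [set i | ultra_repr (ultra_class f) i = f i].
Proof. by apply/ultra_eq_class; rewrite -ultra_reprE. Qed.

Lemma ultra_repr_eq p q :
  p = q <-> G [set i | ultra_repr p i = ultra_repr q i].
Proof.
rewrite ultra_eq_class -!ultra_reprE; split=> [->//|].
by case: p q => [p Pp] [q Pq] /= pq; apply: eq_exist.
Qed.

Lemma ultra_nonempty : inhabited ultra_carrier.
Proof.
apply: inhabits (ultra_class _) => i; apply: inhabited_witness.
exact: carrier_nonempty.
Qed.

(** Reading the step relation off chosen representatives avoids any check of compatibility with the
    quotient. *)
Definition ultraproduct : ARS :=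
  @mkARS ultra_carrier
    (fun p q => G [set i | step (ultra_repr p i) (ultra_repr q i)])
    ultra_nonempty.

Let coordinate (v : nat -> ultraproduct) i : nat -> B i :=
  fun x => ultra_repr (v x) i.

Lemma coordinate_update v x p i :
  coordinate (update _ v x p) i = update _ (coordinate v i) x (ultra_repr p i).
Proof. by apply/funext => y; rewrite /coordinate /update; case: Nat.eqb. Qed.

(** The quantifier case of Łoś's theorem: if the right-hand set were not [G]-large, counterexamples
    chosen coordinatewise would form one point of the ultraproduct violating the left-hand side. *)
Lemma ultra_forall (P : forall i, B i -> Prop) :
  (forall p, G [set i | P i (ultra_repr p i)]) <-> G [set i | forall b, P i b].
Proof.
split=> [GP|GP p]; last by apply: filterS GP => i; apply.
apply: contrapT => /(ultraN GU) GNP.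
(* In each coordinate, pick a counterexample to [P i] if there is one, and any element otherwise. *)
have f i : {b : B i | P i b -> forall b, P i b}.
  apply: cid; have [Pi|/existsNP[b NPb]] := pselect (forall b, P i b).
    by have [b] := carrier_nonempty (B i); exists b.
  by exists b.
(* The representative of the class of [g] agrees with [g] only on a [G]-large set, so a coordinate
   is taken in the intersection of three [G]-large sets. *)
pose g i := sval (f i).
have [i [/= Pi [gi NP]]] :=
  filter_ex (filterI (GP (ultra_class g)) (filterI (ultra_repr_class g) GNP)).
by apply: NP; apply: (svalP (f i)); rewrite -[sval _]gi.
Qed.

Lemma ultra_exists (P : forall i, B i -> Prop) :
  (exists p, G [set i | P i (ultra_repr p i)]) <-> G [set i | exists b, P i b].
Proof.
split=> [[p GP]|GP]; first by apply: filterS GP => i Pi; exists (ultra_repr p i).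
apply: contrapT => NP; have GN : G [set i | forall b, ~ P i b].
  apply/(ultra_forall (fun i b => ~ P i b)) => p.
  by apply/(ultraN GU) => GPp; apply: NP; exists p.
by have [i [[b Pb] /(_ b)]] := filter_ex (filterI GP GN).
Qed.

(** Induction on [f]: step atoms hold by definition, equality because points are classes,
    connectives by the ultrafilter laws, and quantifiers by [ultra_forall] and [ultra_exists]. *)
Theorem Los (v : nat -> ultraproduct) (f : formula) :
  holds _ v f <-> G [set i | holds (B i) (coordinate v i) f].
Proof.
elim: f v => /=.
- by move=> x y v; exact: ultra_repr_eq.
- by [].
- by move=> v; split=> // /filter_ex[].
- by move=> f IHf v; rewrite IHf (ultraN GU).
- by move=> f IHf g IHg v; rewrite IHf IHg (ultraI GU).
- by move=> f IHf g IHg v; rewrite IHf IHg (ultraU GU).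
- by move=> f IHf g IHg v; rewrite IHf IHg (ultra_imply GU).
- move=> x f IHf v; rewrite -ultra_forall.
  by split=> H p; have := H p; rewrite IHf; apply: filterS => i /=;
    rewrite coordinate_update.
- move=> x f IHf v; rewrite -ultra_exists.
  by split=> -[p Hp]; exists p; move: Hp; rewrite IHf; apply: filterS => i /=;
    rewrite coordinate_update.
Qed.

Corollary Los_models (f : formula) :
  sentence f -> models ultraproduct f <-> G [set i | models (B i) f].
Proof.
move=> sf; have [p] := ultra_nonempty.
rewrite (models_sentence (fun=> p : ultraproduct) sf) Los.
by split; apply: filterS => i /= /(models_sentence _ sf).
Qed.

End Ultraproduct.

Definition axiomatises (F : set formula) (P : ARS -> Prop) : Prop :=
  (forall f, F f -> sentence f) /\
  forall A, P A <-> (forall f, F f -> models A f).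

Lemma not_first_order_approx (F : set formula) (P : ARS -> Prop)
    (B : nat -> ARS) :
  axiomatises F P -> (forall f, F f -> \forall n \near \oo, models (B n) f) ->
  (forall n, ~ P (B n)) -> ~ first_order_property P.
Proof.
move=> [sF FP] FB NPB [f [sf fP]].
(* [G] refines the filter of eventual truth, so every axiom in [F] holds on a [G]-large set of
   indices. *)
have [G [GU ooG]] := ultraFilterLemma eventually_filter.
have /fP/(Los_models GU _ sf)/filter_ex[n /fP] : P (ultraproduct G B).
  by apply/FP => g Fg; apply/(Los_models GU _ (sF _ Fg))/ooG/FB.
exact: NPB.
Qed.

(** * Paths of bounded length *)

Fixpoint relpow (T : Type) (R : relation T) (k : nat) (a b : T) : Prop :=
  if k is k'.+1 then exists2 c, R a c & relpow R k' c b else a = b.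

Lemma clos_rt_relpow (T : Type) (R : relation T) (a b : T) :
  clos_refl_trans T R a b <-> exists k, relpow R k a b.
Proof.
split=> [/clos_rt_rt1n_iff|[k]].
  by elim=> [c|c d e cd _ [k de]]; [exists 0 | exists k.+1; exists d].
elim: k a => [a ->|k IHk a [c ac /IHk cb]]; first exact: rt_refl.
by apply: rt_trans cb; apply: rt_step.
Qed.

Lemma clos_t_relpow (T : Type) (R : relation T) (a b : T) :
  clos_trans T R a b <-> exists k, relpow R k.+1 a b.
Proof.
split=> [/clos_trans_t1n_iff|[k]].
  elim=> [c d cd|c d e cd _ [k de]]; first by exists 0, d.
  by exists k.+1, d.
elim: k a => [a [c ac <-]|k IHk a [c ac /IHk cb]]; first exact: t_step.
by apply: t_trans cb; apply: t_step.
Qed.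

(* Two bound variables suffice: [x] and [x'] exchange roles at each step. *)
Fixpoint path_formula (e : nat -> nat -> formula) (k x x' y : nat) : formula :=
  if k is k'.+1 then FEx x' (FAnd (e x x') (path_formula e k' x' x y))
  else FEq x y.

Lemma free_path_formula (e : nat -> nat -> formula) k x x' y z :
  (forall x y, free_in z (e x y) -> z = x \/ z = y) ->
  free_in z (path_formula e k x x' y) -> z = x \/ z = y.
Proof.
move=> ez; elim: k x x' => [//|k IHk] x x' /= [zx' [/ez|/IHk]]; tauto.
Qed.

(** Distinctness of the three variables ensures that binding [x'] overwrites neither the current
    point [x] nor the endpoint [y]; this condition survives the exchange of [x] and [x']. *)
Lemma holds_path_formula (A : ARS) (R : relation A)
    (e : nat -> nat -> formula) k x x' y (v : nat -> A) :
  (forall v x y, holds A v (e x y) <-> R (v x) (v y)) ->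
  x <> y -> x' <> y -> x <> x' ->
  holds A v (path_formula e k x x' y) <-> relpow R k (v x) (v y).
Proof.
move=> eR; elim: k x x' v => [//|k IHk] x x' v xy x'y xx' /=.
have upd c : update A v x' c x' = c /\ update A v x' c x = v x
    /\ update A v x' c y = v y.
  by rewrite /update; split; [|split]; case: PeanoNat.Nat.eqb_spec; congruence.
split=> -[c].
  by rewrite eR IHk; [|congruence..]; have [-> [-> ->]] := upd c => -[]; exists c.
move=> vc cv; exists c; rewrite eR IHk; [|congruence..].
by have [-> [-> ->]] := upd c.
Qed.

Arguments path_formula : simpl never.

(** * First-order axioms for the three properties *)

Definition sym_step (x y : nat) : formula := FOr (FStep x y) (FStep y x).

Definition nf_formula (x x' : nat) : formula := FNot (FEx x' (FStep x x')).

Definition AC_formula (k : nat) : formula :=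
  FAll 0 (FAll 1 (FImp (path_formula FStep k 0 2 1) (FNot (FEq 0 1)))).

Definition UN_formula (k : nat) : formula :=
  FAll 0 (FAll 1 (FImp (nf_formula 0 2) (FImp (nf_formula 1 2)
    (FImp (path_formula sym_step k 0 2 1) (FEq 0 1))))).

(** Variable 3 is the top of the peak and 2 is auxiliary. Each path may rebind both, but only within
    its own scope, so the two paths start at the same point. *)
Definition UN_to_formula (i j : nat) : formula :=
  FAll 0 (FAll 1 (FImp (nf_formula 0 2) (FImp (nf_formula 1 2)
    (FImp (FEx 3 (FAnd (path_formula FStep i 3 2 0) (path_formula FStep j 3 2 1)))
      (FEq 0 1))))).

Lemma free_step_path k x x' y z :
  free_in z (path_formula FStep k x x' y) -> z = x \/ z = y.
Proof. exact: free_path_formula. Qed.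

Lemma free_sym_path k x x' y z :
  free_in z (path_formula sym_step k x x' y) -> z = x \/ z = y.
Proof. by apply: free_path_formula => {}x {}y /=; tauto. Qed.

Lemma AC_sentence k : sentence (AC_formula k).
Proof. by move=> z /=; have := @free_step_path k 0 2 1 z; tauto. Qed.

Lemma UN_sentence k : sentence (UN_formula k).
Proof. by move=> z /=; have := @free_sym_path k 0 2 1 z; tauto. Qed.

Lemma UN_to_sentence i j : sentence (UN_to_formula i j).
Proof.
move=> z /=; have := @free_step_path i 3 2 0 z.
by have := @free_step_path j 3 2 1 z; tauto.
Qed.

Section Semantics.
Variable A : ARS.

Lemma holds_step_path k x x' y (v : nat -> A) :
  x <> y -> x' <> y -> x <> x' ->
  holds A v (path_formula FStep k x x' y) <-> relpow step k (v x) (v y).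
Proof. exact: holds_path_formula. Qed.

Lemma holds_sym_path k x x' y (v : nat -> A) :
  x <> y -> x' <> y -> x <> x' ->
  holds A v (path_formula sym_step k x x' y) <->
  relpow (union A step (transp A step)) k (v x) (v y).
Proof. exact: holds_path_formula. Qed.

Lemma models_AC_formula k :
  models A (AC_formula k) <-> forall a b : A, relpow step k a b -> a <> b.
Proof.
split=> [H a b|H v /= a b]; last by rewrite holds_step_path //; exact: H.
by have /= /(_ a b) := H (fun=> a); rewrite holds_step_path.
Qed.

Lemma models_UN_formula k :
  models A (UN_formula k) <-> forall a b : A, normal_form A a ->
    normal_form A b -> relpow (union A step (transp A step)) k a b -> a = b.
Proof.
split=> [H a b|H v /= a b].
  by have /= /(_ a b) := H (fun=> a); rewrite holds_sym_path.
by move=> na nb; rewrite holds_sym_path //; exact: H.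
Qed.

Lemma models_UN_to_formula i j :
  models A (UN_to_formula i j) <-> forall a b : A, normal_form A a ->
    normal_form A b ->
    (exists x : A, relpow step i x a /\ relpow step j x b) -> a = b.
Proof.
split=> [H a b na nb [x [xa xb]]|H v /= a b].
  have /= /(_ a b na nb) := H (fun=> a); apply.
  by exists x; rewrite !holds_step_path.
move=> na nb [x]; rewrite !holds_step_path // => xab.
by apply: H na nb _; exists x.
Qed.

End Semantics.

(** Composing with [S] excludes length 0, for which the formula would require every point to differ
    from itself. *)
Lemma AC_axioms : axiomatises (range (AC_formula \o S)) AC.
Proof.
split=> [_ [k _ <-]|A]; first exact: AC_sentence.
split=> [acA _ [k _ <-]|H a b /clos_t_relpow[k ab]].
  by apply/models_AC_formula => a b ab; apply/acA/clos_t_relpow; exists k.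
by have /models_AC_formula := H _ (imageT (AC_formula \o S) k); apply.
Qed.

Lemma UN_axioms : axiomatises (range UN_formula) UN.
Proof.
split=> [_ [k _ <-]|A]; first exact: UN_sentence.
split=> [unA _ [k _ <-]|H a b na nb /clos_rt_relpow[k ab]].
  apply/models_UN_formula => a b na nb ab.
  by apply: unA => //; apply/clos_rt_relpow; exists k.
by have /models_UN_formula := H _ (imageT UN_formula k); apply.
Qed.

Lemma UN_to_axioms :
  axiomatises [set f | exists i j, f = UN_to_formula i j] UN_to.
Proof.
split=> [_ [i [j ->]]|A]; first exact: UN_to_sentence.
split=> [unA _ [i [j ->]]|H a b na nb [x []]].
  apply/models_UN_to_formula => a b na nb [x [xa xb]].
  apply: unA => //; exists x.
  by split; apply/clos_rt_relpow; [exists i|exists j].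
move=> /clos_rt_relpow[i xa] /clos_rt_relpow[j xb].
have /models_UN_to_formula : models A (UN_to_formula i j).
  by apply: H; exists i, j.
by apply=> //; exists x.
Qed.

Lemma axiomatises_generalised F P :
  axiomatises F P -> generalised_first_order_property P.
Proof. by exists F. Qed.

(** * Systems with long cycles or long peaks *)

Local Open Scope ring_scope.

(* The integers modulo [n.+1], each class blown up to infinitely many copies. *)
Definition cycle_ars (n : nat) : ARS :=
  @mkARS int (fun x y => exists q, y = x + 1 + q * n.+1%:Z) (inhabits 0).

Lemma cycle_relpow n k (a b : cycle_ars n) :
  relpow step k a b -> exists q : int, b = a + k%:Z + q * n.+1%:Z :> int.
Proof.
elim: k a => [a ->|k IHk a [_ [q ->] /IHk[r ->]]]; first by exists 0; lia.
by exists (q + r); lia.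
Qed.

Lemma cycle_not_AC n : ~ AC (cycle_ars n).
Proof.
(* The path first jumps from 0 to [- n], using the quotient [- 1], and then climbs by 1 at each
   step; for [k = n] it is back at 0. *)
suff c (k : nat) : steps_plus (cycle_ars n) 0 (k.+1%:Z + (- 1) * n.+1%:Z).
  by move=> /(_ 0 _ (c n)); apply; lia.
elim: k => [|k IHk]; first by apply: t_step; exists (- 1); lia.
by apply: t_trans IHk _; apply: t_step; exists 0; lia.
Qed.

(** A cycle of length [k.+1] would make [n.+1] divide [k.+1], which is impossible once [n] is at
    least [k.+1]. *)
Lemma cycle_AC_formula k :
  \forall n \near \oo, models (cycle_ars n) (AC_formula k.+1).
Proof.
exists k.+1 => // n /= kn; apply/models_AC_formula => a b /cycle_relpow[q bq] ab.
have qE : k.+1%:Z + q * n.+1%:Z = 0 by rewrite -ab in bq; lia.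
by have [q0|q0] := lerP 0 q; nia.
Qed.

(* The peak [- n <- ... <- 0 -> ... -> n], where the integers beyond [n] and
   [- n] form two separate infinite paths without normal forms. *)
Definition peak_ars (n : nat) : ARS :=
  @mkARS int (fun x y => (0 <= x /\ x <> n%:Z /\ y = x + 1) \/
                         (x <= 0 /\ x <> - n%:Z /\ y = x - 1)) (inhabits 0).

Lemma peak_normal_form n (a : peak_ars n.+1) :
  normal_form _ a <-> a = n.+1%:Z :> int \/ a = - n.+1%:Z :> int.
Proof.
split=> [na|an [b /=]]; last by lia.
apply: contrapT => Na; apply: na.
have [a0|a0] := lerP 0 (a : int).
  by exists ((a : int) + 1) => /=; lia.
by exists ((a : int) - 1) => /=; lia.
Qed.

(** Each step moves by exactly 1. The general [R] covers both rewrite paths and conversions. *)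
Lemma peak_relpow n k (R : relation (peak_ars n)) (a b : peak_ars n) :
  (forall x y, R x y -> step x y \/ step y x) ->
  relpow R k a b -> (`|(a : int) - (b : int)| <= k%:Z).
Proof.
move=> Rstep; elim: k a => [a ->|k IHk a [c /Rstep /= ac /IHk]]; lia.
Qed.

Lemma peak_steps n (k : nat) : (k <= n)%N ->
  steps (peak_ars n) 0 k%:Z /\ steps (peak_ars n) 0 (- k%:Z).
Proof.
elim: k => [_|k IHk kn]; first by split; apply: rt_refl.
have [p m] := IHk (ltnW kn); split.
  by apply: rt_trans p _; apply: rt_step => /=; lia.
by apply: rt_trans m _; apply: rt_step => /=; lia.
Qed.

(** The index starts at 1 because in [peak_ars 0] both ends of the peak are the point 0. *)
Lemma peak_not_UN_to n : ~ UN_to (peak_ars n.+1).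
Proof.
move=> un; have /= : n.+1%:Z = - n.+1%:Z :> int; last by lia.
apply: un; [apply/peak_normal_form; lia..|].
by exists 0; exact: peak_steps.
Qed.

(** The two legs of a peak form a conversion. Contrapositively, the peaks refuting [UN_to] refute
    [UN] too. *)
Lemma UN_UN_to A : UN A -> UN_to A.
Proof.
move=> un a b na nb [x [xa xb]]; apply: un => //.
have inc c : steps A x c -> conv A x c /\ conv A c x.
  elim=> {x c xa xb} [x c xc|x|x y z _ [xy yx] _ [yz zy]].
  - by split; apply: rt_step; [left|right].
  - by split; apply: rt_refl.
  - by split; [apply: rt_trans yz|apply: rt_trans yx].
by apply: rt_trans (inc _ xa).2 (inc _ xb).1.
Qed.

(** Distinct normal forms lie [2 * n.+1] apart, too far for a conversion of length [k] when [n] is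
    at least [k]. *)
Lemma peak_UN_formula k :
  \forall n \near \oo, models (peak_ars n.+1) (UN_formula k).
Proof.
exists k => // n /= kn; apply/models_UN_formula => a b.
move=> /peak_normal_form na /peak_normal_form nb /peak_relpow.
by move=> /(_ (fun _ _ => id)); lia.
Qed.

Lemma peak_UN_to_formula i j :
  \forall n \near \oo, models (peak_ars n.+1) (UN_to_formula i j).
Proof.
(* By the triangle inequality through [x], the two normal forms are at most [i + j] apart, less than
   the distance between the two ends. *)
exists (i + j)%N => // n /= ijn; apply/models_UN_to_formula => a b.
move=> /peak_normal_form na /peak_normal_form nb [x [xa xb]].
have := peak_relpow (fun _ _ => @or_introl _ _) xa.
have := peak_relpow (fun _ _ => @or_introl _ _) xb.
by lia.
Qed.

Theorem theorem3p8 :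
  (generalised_first_order_property AC /\ ~ first_order_property AC) /\
  (generalised_first_order_property UN /\ ~ first_order_property UN) /\
  (generalised_first_order_property UN_to /\ ~ first_order_property UN_to).
Proof.
split; [|split]; split.
- exact: axiomatises_generalised AC_axioms.
- apply: (not_first_order_approx AC_axioms _ cycle_not_AC) => _ [k _ <-].
  exact: cycle_AC_formula.
- exact: axiomatises_generalised UN_axioms.
- apply: (not_first_order_approx (B := fun n => peak_ars n.+1) UN_axioms).
    by move=> _ [k _ <-]; exact: peak_UN_formula.
  by move=> n /UN_UN_to; exact: peak_not_UN_to.
- exact: axiomatises_generalised UN_to_axioms.
- apply: (not_first_order_approx UN_to_axioms _ peak_not_UN_to) => _ [i [j ->]].
  exact: peak_UN_to_formula.
Qed.
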